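(* Let $X$ be a uniformly convex Banach space and let $U$ be a monotonically dissipative m-process acting on $X$, with bounded nonautonomous absorbing set $\mathbb B_0=\{B_0(t):t\in\mathbb R\}$ (satisfying $B_0(s)\subset B_0(t)$ for $s\le t$). The following are equivalent. (1) $U$ is asymptotically compact. (2) For every $t\in\mathbb R$ the set $\omega(t,B_0(t))$ is nonempty, compact and attracts $B_0(t)$, i.e. $\lim_{\tau\to-\infty}\mathrm{dist}\big(U(t,\tau;B_0(t)),\omega(t,B_0(t))\big)=0$. (3) $U$ is pullback $\omega$-limit compact. (4) $U$ is pullback flattening. (5) There exists the backward bounded pullback attractor of $U$.
   Context: $P(X)$ is the family of nonempty subsets of $X$, $\mathcal B(X)$ the family of nonempty bounded subsets of $X$, $\varrho(x,y)=\|x-y\|$, $\mathbb R_d=\{(s,t)\in\mathbb R^2: s\ge t\}$. For a point $y$ and sets $A,B\subset X$: $\mathrm{dist}(y,B)=\inf_{x\in B}\varrho(x,y)$ and $\mathrm{dist}(A,B)=\sup_{y\in A}\mathrm{dist}(y,B)$, with $\inf\emptyset=+\infty$. An m-process on $X$ is a map $U:\mathbb R_d\times X\to P(X)$, $(t,\tau,x)\mapsto U(t,\tau;x)$, such that (i) $U(t,t;x)=\{x\}$ for all $t\in\mathbb R$, $x\in X$; (ii) $U(t,\tau;x)\subset U(t,s;U(s,\tau;x))$ for all $t\ge s\ge\tau$, $x\in X$, where $U(t,s;A)=\bigcup_{y\in A}U(t,s;y)$. No continuity is assumed. A nonautonomous set is a family $\{K(t)\subset X:t\in\mathbb R\}$;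 it is closed (compact, bounded) if every $K(t)$ is; it is backward bounded if $\bigcup_{t\le\tau}K(t)$ is bounded for every $\tau\in\mathbb R$. It is pullback attracting for $U$ if $\lim_{\tau\to-\infty}\mathrm{dist}(U(t,\tau;B),K(t))=0$ for every $t\in\mathbb R$ and $B\in\mathcal B(X)$. A pullback attractor for $U$ is a nonautonomous set that is compact, pullback attracting, and minimal in the class of closed pullback attracting nonautonomous sets (i.e. $A(t)\subset C(t)$ for all $t$ for every closed pullback attracting $\{C(t)\}$). No invariance is required. $\omega(t,B)=\bigcap_{s\le t}\overline{\bigcup_{\tau\le s}U(t,\tau;B)}$. $U$ is (pullback) asymptotically compact if for every $B\in\mathcal B(X)$, $t\in\mathbb R$ and any sequences $\tau_n\to-\infty$, $\xi_n\in U(t,\tau_n;B)$, the sequence $(\xi_n)$ has a subsequence converging in $X$. $\kappa(B)=\inf\{\delta: B$ has a finite cover by balls of $X$ of diameter less than $\delta\}$ ($\inf\emptyset=+\infty$). $U$ is pullback $\omega$-limit compact if for every $B\in\mathcal B(X)$ and $t\in\mathbb R$, $\lim_{\tau\to-\infty}\kappa\big(\bigcup_{s\le\tau}U(t,s;B)\big)=0$. $U$ is pullback flattening if for every $B\in\mathcal B(X)$, $t\in\mathbb R$ and $\varepsilon>0$ there exist $\tau\le t$, a finite dimensional subspace $E$ of $X$ and a mapping $P_E:X\to E$ such that $P_E\big(\bigcup_{s\le\tau}U(t,s;B)\big)\in\mathcal B(X)$ and $(I-P_E)\big(\bigcup_{s\le\tau}U(t,s;B)\big)\subset B(0,\varepsilon)$,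 the ball of radius $\varepsilon$ centered at $0$. $U$ is dissipative if there is a bounded nonautonomous set $\{B_0(t):t\in\mathbb R\}$ (called pullback absorbing) such that for every $E\in\mathcal B(X)$ and $t\in\mathbb R$ there is $\bar\tau=\bar\tau(t,E)\le t$ with $U(t,\tau;E)\subset B_0(t)$ for all $\tau\le\bar\tau$; it is monotonically dissipative if in addition $B_0(s)\subset B_0(t)$ for every $s\le t$. *)

(* Defs.v *)
From HB Require Import structures.
From mathcomp Require Import all_boot all_order all_algebra.
From mathcomp Require Import all_classical all_reals all_analysis.
Import Order.TTheory GRing.Theory Num.Theory.
Import numFieldNormedType.Exports.

Set Implicit Arguments.
Unset Strict Implicit.
Unset Printing Implicit Defensive.

Local Open Scope classical_set_scope.
Local Open Scope ring_scope.

Definition uniformly_convex (R : realType) (X : normedModType R) : Prop :=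
  forall eps : R, 0 < eps -> eps <= 2 ->
    exists2 delta : R, 0 < delta &
      forall x y : X, `|x| = 1 -> `|y| = 1 -> eps <= `|x - y| ->
        `|2^-1 *: (x + y)| <= 1 - delta.

Section MetricNotions.
Context {R : realType} {X : normedModType R}.
Implicit Types (A B : set X) (x y : X).

Definition bounded_nonempty B : Prop := B !=set0 /\ bounded_set B.

Definition dist_pt y B : \bar R := ereal_inf [set (`|x - y|)%:E | x in B].

                                                        
Definition dist A B : \bar R := ereal_sup [set dist_pt y B | y in A].

Definition diam A : \bar R :=
  ereal_sup [set d | exists x y, [/\ A x, A y & d = (`|x - y|)%:E]].

                                                                              
                                        
Definition has_finite_ball_cover B (delta : R) : Prop :=
  exists F : set (set X),
    [/\ finite_set F,
        forall D, F D ->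
          (exists x, exists2 r : R, 0 < r & D = ball x r) /\
          (diam D < delta%:E)%E
      & B `<=` \bigcup_(D in F) D].

                                                
Definition kappa B : \bar R :=
  ereal_inf [set delta%:E | delta in
               [set delta : R | 0 < delta /\ has_finite_ball_cover B delta]].

Definition finite_dim_subspace (E : set X) : Prop :=
  exists (n : nat) (e : 'I_n -> X),
    E = [set x | exists c : 'I_n -> R, x = \sum_(i < n) c i *: e i].

End MetricNotions.

Section Processes.
Context {R : realType} {X : normedModType R}.

                                                                            
                                                        
Implicit Types (U : R -> R -> X -> set X) (B C : set X) (K : R -> set X).

Definition image_process U (t tau : R) B : set X := \bigcup_(y in B) U t tau y.

Definition m_process U : Prop :=
  [/\ forall t tau x, tau <= t -> U t tau x !=set0,
      forall t x, U t t x = [set x]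
    & forall t s tau x, tau <= s -> s <= t ->
        U t tau x `<=` image_process U t s (U s tau x)].

                                                                             
                                         
Definition past_image U (t tau : R) B : set X :=
  \bigcup_(s in [set s | s <= tau]) image_process U t s B.

Definition omega_limit U (t : R) B : set X :=
  \bigcap_(s in [set s | s <= t]) closure (past_image U t s B).

Definition attracts_at U (t : R) B C : Prop :=
  dist (image_process U t tau B) C @[tau --> -oo%R] --> 0%E.

Definition closed_nonautonomous K : Prop := forall t, closed (K t).
Definition compact_nonautonomous K : Prop := forall t, compact (K t).
Definition bounded_nonautonomous K : Prop := forall t, bounded_set (K t).

Definition backward_bounded K : Prop :=
  forall tau, bounded_set (\bigcup_(t in [set t | t <= tau]) K t).

Definition pullback_attracting U K : Prop :=
  forall t B, bounded_nonempty B -> attracts_at U t B (K t).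

Definition pullback_attractor U K : Prop :=
  [/\ compact_nonautonomous K,
      pullback_attracting U K
    & forall C : R -> set X, closed_nonautonomous C ->
        pullback_attracting U C -> forall t, K t `<=` C t].

Definition asymptotically_compact U : Prop :=
  forall B t, bounded_nonempty B ->
  forall (tau : nat -> R) (xi : nat -> X),
    (forall n, tau n <= t) -> tau n @[n --> \oo] --> -oo%R ->
    (forall n, image_process U t (tau n) B (xi n)) ->
    exists2 f : nat -> nat, increasing_seq f & cvgn (xi \o f).

Definition omega_limit_compact U : Prop :=
  forall B t, bounded_nonempty B ->
    kappa (past_image U t tau B) @[tau --> -oo%R] --> 0%E.

                                                                         
Definition pullback_flattening U : Prop :=
  forall B t (eps : R), bounded_nonempty B -> 0 < eps ->
    exists (tau : R) (E : set X) (P : X -> X),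
      [/\ tau <= t,
          finite_dim_subspace E,
          forall x, E (P x),
          bounded_nonempty (P @` past_image U t tau B)
        & (fun x => x - P x) @` past_image U t tau B `<=` ball 0 eps].

Definition pullback_absorbing U K : Prop :=
  bounded_nonautonomous K /\
  forall B t, bounded_nonempty B ->
    exists2 tau0, tau0 <= t &
      forall tau, tau <= tau0 -> image_process U t tau B `<=` K t.

                                                                         
           
Definition monotonically_dissipative_with U (B0 : R -> set X) : Prop :=
  pullback_absorbing U B0 /\ forall s t, s <= t -> B0 s `<=` B0 t.

End Processes.

(* Main.v *)
Require Import Defs.
From HB Require Import structures.
From mathcomp Require Import all_boot all_order all_algebra.
From mathcomp Require Import all_classical all_reals all_analysis.
Import Order.TTheory GRing.Theory Num.Theory.
Import numFieldNormedType.Exports.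

Local Open Scope classical_set_scope.
Local Open Scope ring_scope.

(** All five conditions say that the far past of every bounded set, seen at
    time t, is totally bounded in the limit: for every radius eps there is
    tau <= t such that the union of the images U(t, s; B) over s <= tau is
    covered by finitely many eps-balls ([past_finite_nets]).  This is what
    omega-limit compactness means once the measure of noncompactness kappa is
    spelled out ([omega_limit_compactP]), and each other condition is compared
    with it.

    - Asymptotic compactness: if no past image had a finite eps-net, one could
      pick xi_n in the n-th past image at distance at least eps from all earlier
      xi_m, and such a sequence has no convergent subsequence.  Conversely,
      completeness gives a form of Cantor's intersection theorem for decreasing
      sets whose noncompactness tends to 0 ([nested_closure_nonempty]); applied
      to the tails of (xi_n) it produces a cluster point.
    - The omega-limit set: the same intersection theorem, applied to the past
      images themselves and to the parts of them that stay eps-far from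
      omega(t, B), shows that omega(t, B) is nonempty and attracts B; it is
      closed and totally bounded, hence compact.
    - Attractors: a compact attracting set has finite nets, and these are also
      nets, for a larger radius, of the past images close to it.
    - Flattening: given a finite eps-net, P_E may send a point to a centre at
      distance less than eps, and E is the span of the centres.  Conversely,
      the image of P_E is bounded in a finite dimensional space, hence totally
      bounded, and the past image is eps-close to it.

    Dissipativity reduces every bounded set to the absorbing family: the
    evolution of B from a sufficiently remote s to t passes at an intermediate
    time r through B_0(r), which monotonicity places in B_0(t), so that
    U(t, s; B) lies in U(t, r; B_0(t)) ([past_image_absorbed]).  Hence any
    family that attracts each B_0(t) at time t is pullback attracting, and the
    pullback attractor is t |-> omega(t, B_0(t)): it lies in every closed
    attracting family ([omega_limit_minimal]), and monotonicity also gives its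
    backward boundedness, as its section at t <= T is contained in the closure
    of B_0(T). *)

Set Implicit Arguments.
Unset Strict Implicit.
Unset Printing Implicit Defensive.

(** * Finite nets, completeness and compactness *)

Definition finite_net {R : realType} {X : normedModType R} (eps : R)
    (A : set X) : Prop :=
  exists s : seq X, A `<=` \bigcup_(c in [set` s]) ball c eps.

Section Nets.
Context {R : realType} {X : normedModType R}.
Implicit Types (A B S : set X) (eps : R).

Lemma finite_netS A B eps : A `<=` B -> finite_net eps B -> finite_net eps A.
Proof. by move=> AB [s sB]; exists s; apply: subset_trans sB. Qed.

Lemma finite_net_near A B eps del :
    (forall x, A x -> exists2 y, B y & `|x - y| < del) ->
  finite_net eps B -> finite_net (eps + del) A.
Proof.
move=> AB [s sB]; exists s => x /AB[y /sB[c sc]]; rewrite -ball_normE => cy xy.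
exists c => //; rewrite /ball_ /=.
by rewrite (le_lt_trans (ler_distD y _ _))// ltrD// distrC.
Qed.

Lemma compact_finite_net A eps : 0 < eps -> compact A -> finite_net eps A.
Proof.
move=> e0; rewrite compact_cover => /(_ X A (fun c => ball c eps)) [].
- by move=> c _; exact: ball_open.
- by move=> x Ax; exists x => //; exact: ballxx.
by move=> D _ AD; exists (finmap.enum_fset D).
Qed.

(** An ultrafilter that contains a finite union contains one of its members:
    this is how total boundedness makes ultrafilters Cauchy. *)
Lemma ultra_finite_net (G : set_system X) A eps : UltraFilter G ->
  G A -> finite_net eps A -> exists c, G (ball c eps).
Proof.
move=> UG GA [s sA]; have {GA sA} : G (\bigcup_(c in [set` s]) ball c eps).
  exact: filterS GA.
have FG : ProperFilter G by exact: ultra_proper.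
elim: s => [|c s IH].
  rewrite set_nil bigcup_set0 => G0; exfalso; exact: filter_not_empty G0.
have [Gc _|Gc Gs] := in_ultra_setVsetC (ball c eps) UG; first by exists c.
apply: IH; apply: filterS2 Gc Gs => x /= ncx [d]; rewrite /= inE.
by move=> /orP[/eqP ->//|ds dx]; exists d.
Qed.

(** Each term exists because the balls around the finitely many earlier terms
    fail to cover the next set. *)
Lemma separated_seq (S : nat -> set X) eps :
    (forall n, ~ finite_net eps (S n)) ->
  exists xi : nat -> X, (forall n, S n (xi n)) /\
    forall m n, (m < n)%N -> eps <= `|xi m - xi n|.
Proof.
move=> nS; pose Q (s : seq X) x := S (size s) x /\
  forall c, c \in s -> eps <= `|c - x|.
have /choice[g gQ] : forall s, exists x, Q s x.
  move=> s; apply: contra_notP (nS (size s)) => /forallNP nx; exists s => x Sx.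
  have /not_andP[//|/existsNP[c /not_implyP[cs /negP]]] := nx x.
  by rewrite -ltNge => cx; exists c => //; rewrite -ball_normE.
(* L n lists the first n terms, the most recent one first. *)
pose L := fix L n := if n is m.+1 then g (L m) :: L m else [::].
have sL n : size (L n) = n by elim: n => //= n ->.
exists (fun n => g (L n)); split=> [n|m n mn].
  by have [] := gQ (L n); rewrite sL.
apply: (gQ (L n)).2; elim: n mn => // n IH; rewrite ltnS leq_eqVlt /= inE.
by move=> /orP[/eqP ->|/IH ->]; rewrite ?eqxx ?orbT.
Qed.

End Nets.

Section Complete.
Context {R : realType} {X : completeNormedModType R}.

Lemma ultra_finite_net_cvg (G : set_system X) : UltraFilter G ->
    (forall eps : R, 0 < eps -> exists2 A, G A & finite_net eps A) ->
  exists p : X, G --> p.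
Proof.
move=> UG nG; have FG : ProperFilter G by exact: ultra_proper.
apply/cvg_ex; apply: (@cauchy_cvg X G FG); apply: cauchy_exP => e e0.
have [A GA nA] := nG e e0.
exact: ultra_finite_net GA nA.
Qed.

Lemma closed_finite_net_compact (A : set X) : closed A ->
  (forall eps, 0 < eps -> finite_net eps A) -> compact A.
Proof.
move=> cA nA; rewrite compact_ultra => G UG GA.
have [|p Gp] := @ultra_finite_net_cvg G UG.
  by move=> e e0; exists A; auto.
exists p; split => //; have FG : ProperFilter G by exact: ultra_proper.
by apply: cA => V /Gp GV; exact: (@filter_ex _ G _ _ (filterI GA GV)).
Qed.

(** The Cantor-Kuratowski intersection theorem.  The sets S n generate a proper
    filter; an ultrafilter above it is Cauchy by the nets, and its limit is
    adherent to every S n. *)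
Lemma nested_closure_nonempty (S : nat -> set X) :
    (forall n, S n !=set0) ->
    (forall m n, (m <= n)%N -> S n `<=` S m) ->
    (forall eps, 0 < eps -> exists n, finite_net eps (S n)) ->
  (\bigcap_n closure (S n)) !=set0.
Proof.
move=> S0 Smono nS.
have FS : ProperFilter (filter_from [set: nat] S).
  apply: filter_from_proper => [|n _]; last exact: S0.
  apply: filter_from_filter; first by exists 0%N.
  move=> i j _ _; exists (maxn i j) => // x Sx.
  by split; apply: Smono Sx; rewrite (leq_maxl, leq_maxr).
have [G [UG SG]] := ultraFilterLemma FS.
have GS n : G (S n) by apply: SG; exists n.
have [|p Gp] := @ultra_finite_net_cvg G UG.
  by move=> e /nS[n nSn]; exists (S n).
exists p => n _ V /Gp GV; have FG : ProperFilter G by exact: ultra_proper.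
exact: (@filter_ex _ G _ _ (filterI (GS n) GV)).
Qed.

End Complete.

(** * Finite dimensional subspaces *)

Section FiniteDimension.
Context {R : realType} {X : normedModType R}.
Implicit Types (S : set X) (e : X) (r : R).

(** Compactness of the closed bounded parts is stated for the intersections with
    all balls centred at 0; it is the form of local compactness that passes
    from a subspace to its sum with a line. *)
Definition boundedly_compact_subspace S : Prop :=
  [/\ S 0, forall a x y, S x -> S y -> S (a *: x + y)
    & forall r, compact (S `&` [set x | `|x| <= r])].

Lemma closed_normle r : closed [set x : X | `|x| <= r].
Proof.
have := @closed_closed_ball_ R X 0 r; congr closed.
by apply/seteqP; split=> x; rewrite /closed_ball_ /= sub0r normrN.
Qed.

(** A point adherent to S is adherent to the part of S in a ball around 0, which
    is compact and hence closed. *)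
Lemma boundedly_compact_subspace_closed S :
  boundedly_compact_subspace S -> closed S.
Proof.
move=> [_ _ cS] x Sx; have cSx := cS (`|x| + 1).
suff [] : (S `&` [set y | `|y| <= `|x| + 1]) x by [].
apply: (compact_closed _ cSx) => [|V Vx]; first exact: norm_hausdorff.
have [|y [Sy [Vy]]] := Sx (V `&` ball x 1).
  by apply: filterI => //; exact: nbhsx_ballx.
rewrite -ball_normE => xy; exists y; do !split => //=.
rewrite (_ : y = x - (x - y)); last by rewrite subKr.
rewrite (le_trans (ler_normB _ _))// lerD2l.
exact: ltW.
Qed.

(** If e lies in S nothing changes.  Otherwise e is at a distance d > 0 from the
    closed subspace S, and this bounds the coordinate along e: from
    |k e + s| <= r follows |k| d <= r.  The bounded part of the sum is then the
    trace of the image of a compact set of pairs (k, s). *)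
Lemma boundedly_compact_subspace_add_line S e : boundedly_compact_subspace S ->
  boundedly_compact_subspace [set x | exists k s, S s /\ x = k *: e + s].
Proof.
move=> PS; have [S0 SD cS] := PS.
have SZ a x : S x -> S (a *: x) by move=> Sx; rewrite -[_ *: _]addr0; exact: SD.
set S' := [set x | _].
have [Se|Se] := pselect (S e).
  suff -> : S' = S by [].
  apply/seteqP; split=> [_ [k [s [Ss ->]]]|s Ss]; first exact: SD.
  by exists 0, s; rewrite scale0r add0r.
split=> [|a _ _ [k [s [Ss ->]]] [l [t [St ->]]]|r].
- by exists 0, 0; rewrite scale0r addr0.
- exists (a * k + l), (a *: s + t); split; first exact: SD.
  by rewrite scalerDr scalerDl scalerA addrACA.
(* S is closed and e is not in S. *)
have [d d0 dS] : exists2 d, 0 < d & forall s, S s -> d <= `|e - s|.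
  have : nbhs e (~` S).
    apply: open_nbhs_nbhs; split => //.
    by apply: closed_openC; exact: boundedly_compact_subspace_closed.
  move=> /nbhs_ballP[d /= d0 dS]; exists d => // s Ss; rewrite leNgt.
  by apply/negP => es; apply: (dS s) => //; rewrite -ball_normE.
pose f (p : R * X) : X := p.1 *: e + p.2.
pose K := `[- (r / d), r / d]%classic `*` (S `&` [set s | `|s| <= r + r / d * `|e|]).
have cK : compact (f @` K).
  apply: continuous_compact; last by apply: compact_setX => //; exact: segment_compact.
  apply: continuous_subspaceT => p; apply: cvgD; last exact: cvg_snd.
  by apply: cvgZr_tmp; exact: cvg_fst.
suff -> : S' `&` [set x | `|x| <= r] = f @` K `&` [set x | `|x| <= r].
  by apply: compact_closedI => //; exact: closed_normle.
apply/seteqP; split=> [x [[k [s [Ss ->]]] /= xr]|x [[[k s] [/= _ [Ss _]] <-] xr]];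
  last by split => //; exists k, s.
have kd : `|k| <= r / d.
  rewrite ler_pdivlMr//; apply: le_trans xr; have [->|k0] := eqVneq k 0.
    by rewrite normr0 mul0r.
  have -> : k *: e + s = k *: (e - (- k^-1) *: s).
    by rewrite scalerBr scalerA mulrN divff// scaleN1r opprK.
  by rewrite normrZ ler_wpM2l// dS//; exact: SZ.
split => //; exists (k, s) => //; split; rewrite /= ?in_itv/= -?ler_norml//.
split => //; have -> : s = (k *: e + s) - k *: e by rewrite addrC addKr.
by rewrite (le_trans (ler_normB _ _))// lerD// normrZ ler_wpM2r.
Qed.

Lemma finite_dim_boundedly_compact S :
  finite_dim_subspace S -> boundedly_compact_subspace S.
Proof.
move=> [n [e ->]]; elim: n e => [|n IH] e.
  have -> : [set x | exists c : 'I_0 -> R, x = \sum_(i < 0) c i *: e i] = [set 0].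
    apply/seteqP; split=> [_ [c ->]|_ ->]; first by rewrite big_ord0.
    by exists (fun=> 0); rewrite big_ord0.
  split=> [//|a _ _ -> ->|r]; first by rewrite scaler0 addr0.
  by apply: compact_closedI; [exact: compact_set1|exact: closed_normle].
have := boundedly_compact_subspace_add_line (e ord0) (IH (e \o lift ord0)).
congr boundedly_compact_subspace.
apply/seteqP; split=> [_ [k [_ [[c ->] ->]]]|_ [c ->]].
  exists (fun i => if unlift ord0 i is Some j then c j else k).
  by rewrite big_ord_recl unlift_none; congr (_ + _); apply: eq_bigr => i _; rewrite liftK.
exists (c ord0), (\sum_(i < n) c (lift ord0 i) *: e (lift ord0 i)).
by split; [exists (c \o lift ord0)|rewrite big_ord_recl].
Qed.

Lemma bounded_finite_dim_finite_net A S (eps : R) : 0 < eps ->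
  finite_dim_subspace S -> A `<=` S -> bounded_set A -> finite_net eps A.
Proof.
move=> e0 /finite_dim_boundedly_compact[_ _ cS] AS [M [_ AM]].
apply: (finite_netS _ (compact_finite_net e0 (cS (M + 1)))) => x Ax.
by split; [exact: AS|apply: AM => //; rewrite ltrDl].
Qed.

End FiniteDimension.

(** * The measure of noncompactness *)

Lemma cvge0P {R : realType} {T : Type} {F : set_system T} {FF : Filter F}
    (f : T -> \bar R) : (\forall x \near F, 0 <= f x)%E ->
  f @ F --> 0%E <-> forall eps, 0 < eps -> \forall x \near F, (f x < eps%:E)%E.
Proof.
move=> f0; split=> [f_cvg eps e0|fe A [e /= e0 eA]].
  apply: (f_cvg [set y | (y < eps%:E)%E]); apply: open_ereal_lt'.
  by rewrite lte_fin.
suff: \forall x \near F, A (f x) by [].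
near=> x; have : (0 <= f x)%E by near: x.
have : (f x < e%:E)%E by near: x; exact: fe.
case: (f x) => [r| |]//; rewrite lte_fin lee_fin => re r0.
by apply: (eA r); rewrite /= sub0r normrN ger0_norm.
Unshelve. all: by end_near. Qed.

(** The time t is arbitrary: eventuality at -oo may always be tested on half
    lines lying before t, the only times s at which the laws of a process
    constrain U(t, s; B). *)
Lemma near_ninfty_exists_le {R : realType} (P : R -> Prop) (t : R) :
  (\forall s \near -oo, P s) <->
  exists2 tau, tau <= t & forall s, s <= tau -> P s.
Proof.
split=> [[M [_ MP]]|[tau _ tauP]]; last first.
  by exists tau; split=> [|s /ltW]; [exact: num_real|exact: tauP].
exists (Num.min t (M - 1)); first by rewrite ge_min lexx.
move=> s; rewrite le_min => /andP[_ sM]; apply: MP.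
by rewrite (le_lt_trans sM)// gtrDl ltrN10.
Qed.

Section Kappa.
Context {R : realType} {X : normedModType R}.
Implicit Types (A B : set X) (eps : R).

Lemma kappa_ge0 A : (0 <= kappa A)%E.
Proof. by apply/ereal_infP => _ [d [d0 _] <-]; rewrite lee_fin ltW. Qed.

(** A ball of diameter less than eps need not have radius less than eps, but it
    lies in the ball of radius eps with the same centre. *)
Lemma kappa_lt_finite_net A eps : (kappa A < eps%:E)%E -> finite_net eps A.
Proof.
move=> /ereal_inf_lt[_ [d [d0 [F [/finite_seqP[s ->] Fball AF]]] <-]].
rewrite lte_fin => de.
have /choice[g gP] : forall D : set X, exists c, D \in s -> D `<=` ball c eps.
  move=> D; have [Ds|] := boolP (D \in s); last by exists 0.
  have [[x [r r0 Dr]] dD] := Fball _ Ds; exists x => _ y Dy.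
  rewrite -ball_normE /ball_ /= -lte_fin (lt_trans _ (_ : d%:E < _)%E)//.
  apply: le_lt_trans dD; apply: ereal_sup_ubound; exists x, y; split=> //.
  by rewrite Dr; exact: ballxx.
exists (map g s) => x /AF[D /= Ds Dx]; exists (g D); first exact: map_f.
exact: gP Dx.
Qed.

(** An eps-ball has diameter at most 2 eps, and the covers defining kappa need a
    diameter strictly below the threshold; hence the factor 3. *)
Lemma finite_net_kappa A eps : 0 < eps -> finite_net eps A ->
  (kappa A <= (3 * eps)%:E)%E.
Proof.
move=> e0 [s As]; apply: ereal_inf_lbound; exists (3 * eps) => //; split.
  by rewrite mulr_gt0.
exists [set ball c eps | c in [set` s]]; split.
- by apply: finite_image; apply: finite_seq.
- move=> _ [c _ <-]; split; first by exists c, eps.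
  rewrite (@le_lt_trans _ _ (2 * eps)%:E)// ?lte_fin ?ltr_pM2r ?ltr_nat//.
  apply/ereal_supP => _ [x [y [cx cy ->]]]; rewrite lee_fin.
  move: cx cy; rewrite -ball_normE /ball_ /= => cx cy.
  by rewrite mulr_natl mulr2n (le_trans (ler_distD c _ _))// lerD// ltW// distrC.
by move=> x /As[c sc cx]; exists (ball c eps) => //; exists c.
Qed.

End Kappa.

(** * Pullback images and attraction *)

Section Processes.
Context {R : realType} {X : normedModType R}.
Implicit Types (U : R -> R -> X -> set X) (B C : set X) (t s tau eps : R).

Lemma image_processS U t s B C : B `<=` C ->
  image_process U t s B `<=` image_process U t s C.
Proof. by move=> BC x [y /BC Cy yx]; exists y. Qed.

Lemma image_process_nonempty U t s B : m_process U -> s <= t -> B !=set0 ->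
  image_process U t s B !=set0.
Proof. by move=> [U0 _ _] /U0 + [x Bx] => /(_ x)[y xy]; exists y, x. Qed.

Lemma image_process_trans U t s tau B : m_process U -> tau <= s -> s <= t ->
  image_process U t tau B `<=` image_process U t s (image_process U s tau B).
Proof.
move=> [_ _ Utr] taus st y [x Bx /(Utr _ _ _ _ taus st)[z xz zy]].
by exists z => //; exists x.
Qed.

Lemma past_imageS U t s tau B : s <= tau ->
  past_image U t s B `<=` past_image U t tau B.
Proof. by move=> st x [r /= rs xr]; exists r => //=; exact: le_trans st. Qed.

Lemma past_image_nonempty U t s B : m_process U -> s <= t -> B !=set0 ->
  past_image U t s B !=set0.
Proof.
by move=> Up st B0; have [x] := image_process_nonempty Up st B0; exists x, s => /=.
Qed.

(** The supremum defining [dist] is -oo on the empty set; nonemptiness of the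
    images makes the semidistance nonnegative, so that its convergence to 0
    becomes an upper bound. *)
Lemma attracts_atP U t B C : m_process U -> B !=set0 ->
  attracts_at U t B C <->
  forall eps, 0 < eps -> exists2 tau, tau <= t &
    forall y, past_image U t tau B y -> exists2 c, C c & `|y - c| < eps.
Proof.
move=> Up B0; rewrite /attracts_at cvge0P; last first.
  apply/(near_ninfty_exists_le _ t); exists t => // s st.
  have [y By] := image_process_nonempty Up st B0.
  rewrite (@le_trans _ _ (dist_pt y C))//.
    by apply/ereal_infP => _ [c _ <-]; rewrite lee_fin.
  by apply: ereal_sup_ubound; exists y.
split=> h eps e0.
  have /(near_ninfty_exists_le _ t)[tau taut tauP] := h eps e0.
  exists tau => // y [s stau By].
  have : (dist_pt y C < eps%:E)%E.
    by apply: le_lt_trans (tauP s stau); apply: ereal_sup_ubound; exists y.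
  by move=> /ereal_inf_lt[_ [c Cc <-]]; rewrite lte_fin distrC; exists c.
have e20 : 0 < eps / 2 by rewrite divr_gt0.
have [tau taut tauP] := h _ e20.
apply/(near_ninfty_exists_le _ t); exists tau => // s stau.
rewrite (@le_lt_trans _ _ (eps / 2)%:E)//; last first.
  by rewrite lte_fin gtr_pMr// invf_lt1// ltr1n.
apply/ereal_supP => _ [y By <-].
have [|c Cc yc] := tauP y; first by exists s.
apply: (@le_trans _ _ `|c - y|%:E); last by rewrite lee_fin distrC ltW.
by apply: ereal_inf_lbound; exists c.
Qed.

End Processes.

(** * Finite nets of past images *)

(** The eps-delta content of omega-limit compactness at (t, B), to
    which each of the other conditions is compared. *)
Definition past_finite_nets {R : realType} {X : normedModType R}
    (U : R -> R -> X -> set X) (t : R) (B : set X) : Prop :=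
  forall eps, 0 < eps ->
    exists2 tau, tau <= t & finite_net eps (past_image U t tau B).

Section CompactnessCriteria.
Context {R : realType} {X : normedModType R}.
Implicit Types (U : R -> R -> X -> set X) (B C : set X) (t s tau eps : R).

Lemma omega_limit_compactP U : omega_limit_compact U <->
  forall B t, bounded_nonempty B -> past_finite_nets U t B.
Proof.
split=> [oU B t BB|nU B t BB].
  move/cvge0P : (oU B t BB) => + eps e0.
  move=> /(_ (nearW _ _) _ e0)-/(_ (fun=> kappa_ge0 _)).
  move=> /(near_ninfty_exists_le _ t)[tau taut /(_ _ (lexx _)) ktau].
  by exists tau => //; exact: kappa_lt_finite_net ktau.
apply/cvge0P; first by apply: nearW => s; exact: kappa_ge0.
(* 3 * (eps / 4) < eps absorbs the factor of finite_net_kappa. *)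
move=> eps e0; have e40 : 0 < eps / 4 by rewrite divr_gt0.
have [tau taut ntau] := nU B t BB _ e40.
apply/(near_ninfty_exists_le _ t); exists tau => // s stau.
apply: (@le_lt_trans _ _ (3 * (eps / 4))%:E).
  by apply: finite_net_kappa => //; apply: finite_netS ntau; exact: past_imageS.
by rewrite lte_fin mulrCA gtr_pMr// ltr_pdivrMr// mul1r ltr_nat.
Qed.

(** Integer steps into the past are cofinal, so the omega-limit set is governed
    by a sequence of past images, to which [nested_closure_nonempty] applies. *)
Lemma past_image_nat U t s B :
  exists n, past_image U t (t - n%:R) B `<=` past_image U t s B.
Proof.
exists (Num.truncn (t - s)).+1; apply: past_imageS.
by rewrite lerBlDr -lerBlDl ltW// truncnS_gt.
Qed.

Lemma subset_omega_limit U t B :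
  \bigcap_n closure (past_image U t (t - n%:R) B) `<=` omega_limit U t B.
Proof.
move=> p pU s _; have [n ns] := past_image_nat U t s B.
exact: closureS ns _ (pU n I).
Qed.

Lemma past_finite_nets_nat U t B eps : past_finite_nets U t B -> 0 < eps ->
  exists n, finite_net eps (past_image U t (t - n%:R) B).
Proof.
move=> nU /nU[tau _ ntau]; have [n nP] := past_image_nat U t tau B.
by exists n; apply: finite_netS ntau.
Qed.

(** Otherwise an eps-separated sequence could be chosen along past images going
    to -oo, and consecutive terms of a convergent subsequence would contradict
    the separation. *)
Lemma asymptotically_compact_past_finite_nets U t B :
  asymptotically_compact U -> bounded_nonempty B -> past_finite_nets U t B.
Proof.
move=> aU BB eps e0; apply: contrapT => /forall2NP nU.
have [|xi [xiU xi_sep]] :=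
    @separated_seq _ _ (fun n => past_image U t (t - n%:R) B) eps.
  by move=> n; have [|//] := nU (t - n%:R); rewrite gerBl ler0n.
have /choice[tau tauP] : forall n, exists s,
    s <= t - n%:R /\ image_process U t s B (xi n).
  by move=> n; have [s sn xs] := xiU n; exists s.
have [|||f f_incr f_cvg] := aU B t BB tau xi.
- by move=> n; rewrite (le_trans (tauP n).1)// gerBl ler0n.
- apply/cvgrNyPle => A; near=> n; rewrite (le_trans (tauP n).1)// lerBlDl -lerBlDr.
  by near: n; exact: nbhs_infty_ger.
- by move=> n; have [] := tauP n.
have e20 : 0 < eps / 2 by rewrite divr_gt0.
have /cvg_ex[p /cvgrPdist_lt/(_ _ e20)[N _ pN]] := f_cvg.
have := xi_sep (f N) (f N.+1); rewrite leNgt => /(_ _)/negP; apply.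
  by have := f_incr N.+1 N; rewrite leEnat ltnn => /negbT; rewrite -ltnNge.
rewrite (le_lt_trans (ler_distD p _ _))// [ltRHS]splitr ltrD//.
  by rewrite distrC; apply: pN => /=.
by apply: pN => /=.
Unshelve. all: by end_near. Qed.

(** P sends a point of the past image to a centre of a finite eps-net and E is
    the span of the centres, so x - P x is small and P takes finitely many
    values. *)
Lemma past_finite_nets_pullback_flattening U :
  m_process U -> (forall B t, bounded_nonempty B -> past_finite_nets U t B) ->
  pullback_flattening U.
Proof.
move=> Up nU B t eps BB e0; have [tau taut [s sU]] := nU B t BB eps e0.
(* The added 0 serves as the value of P outside the past image. *)
pose s' := 0 :: s; have /choice[P PP] : forall x, exists c,
    c \in s' /\ (past_image U t tau B x -> ball c eps x).
  move=> x; have [/sU[c sc cx]|nx] := pselect (past_image U t tau B x).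
    by exists c; split => //; rewrite inE [_ \in _]sc orbT.
  by exists 0; rewrite inE eqxx.
exists tau, [set x | exists c : 'I_(size s') -> R,
  x = \sum_(i < size s') c i *: s'`_i], P.
split => //.
- by exists (size s'), (fun i => s'`_i).
- move=> x; have := (PP x).1; set y := P x => ys.
  have ys' : (index y s' < size s')%N by rewrite index_mem.
  exists (fun i => (i == Ordinal ys')%:R).
  rewrite (bigD1 (Ordinal ys'))//= eqxx scale1r nth_index// big1 ?addr0//.
  by move=> i /negbTE ->; rewrite scale0r.
- split.
    by have [x] := past_image_nonempty Up taut BB.1; exists (P x), x.
  have [M [Mr MP]] : bounded_set [set` s'].
    by apply/compact_bounded/finite_compact/finite_seq.
  by exists M; split => // z /MP zP _ [x _ <-]; apply: zP; exact: (PP x).1.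
move=> _ [x xU <-]; have := (PP x).2 xU; rewrite -!ball_normE /ball_ /=.
by rewrite sub0r normrN distrC.
Qed.

Lemma pullback_flattening_past_finite_nets U t B : pullback_flattening U ->
  bounded_nonempty B -> past_finite_nets U t B.
Proof.
move=> fU BB eps e0; have e20 : 0 < eps / 2 by rewrite divr_gt0.
have [tau [E [P [taut Edim EP [_ Pbd] Peps]]]] := fU B t _ BB e20.
exists tau => //; rewrite [eps]splitr.
apply: (@finite_net_near _ _ _ (P @` past_image U t tau B)).
  move=> x xU; exists (P x); first by exists x.
  have := Peps (x - P x); rewrite -ball_normE /ball_ /= sub0r normrN.
  by apply; exists x.
by apply: bounded_finite_dim_finite_net Edim _ Pbd => // _ [x _ <-].
Qed.

Lemma compact_attracts_past_finite_nets U t B K : m_process U -> B !=set0 ->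
  compact K -> attracts_at U t B K -> past_finite_nets U t B.
Proof.
move=> Up B0 cK /(attracts_atP _ _ Up B0) aK eps e0.
have e20 : 0 < eps / 2 by rewrite divr_gt0.
have [tau taut tauP] := aK _ e20; exists tau => //.
by rewrite [eps]splitr; apply: finite_net_near tauP _; exact: compact_finite_net.
Qed.

(** A point of omega(t, B) is approached by points of U(t, s; B) with s as
    remote as desired, and these are close to C. *)
Lemma omega_limit_minimal U t B C : m_process U -> B !=set0 -> closed C ->
  attracts_at U t B C -> omega_limit U t B `<=` C.
Proof.
move=> Up B0 cC /(attracts_atP _ _ Up B0) aC p pU; apply: cC => V.
move=> /nbhs_ballP[e /= e0 eV].
have e20 : 0 < e / 2 by rewrite divr_gt0.
have [tau taut tauP] := aC _ e20.
have [|y [/tauP[c Cc yc] py]] := pU tau taut (ball p (e / 2)).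
  exact: nbhsx_ballx.
exists c; split => //; apply: eV; move: py; rewrite -!ball_normE /ball_ /= => py.
by rewrite (le_lt_trans (ler_distD y _ _))// [ltRHS]splitr ltrD.
Qed.

End CompactnessCriteria.

(** * Omega-limit sets in complete spaces *)

Section CompleteProcesses.
Context {R : realType} {X : completeNormedModType R}.
Context {U : R -> R -> X -> set X} (Up : m_process U).
Implicit Types (B C : set X) (t s tau eps : R).

(** Nonemptiness and attraction are two uses of the intersection theorem: for
    the past images, and for their parts at distance at least eps from
    omega(t, B).  The latter parts cannot all be nonempty, since a common
    adherent point would lie in omega(t, B) and at distance at least eps from
    it. *)
Lemma past_finite_nets_omega_limit t B : B !=set0 -> past_finite_nets U t B ->
  [/\ omega_limit U t B !=set0, compact (omega_limit U t B)
    & attracts_at U t B (omega_limit U t B)].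
Proof.
move=> B0 nU; pose S n := past_image U t (t - n%:R) B.
have Smono m n : (m <= n)%N -> S n `<=` S m.
  by move=> mn; apply: past_imageS; rewrite lerB// ler_nat.
have tn n : t - n%:R <= t by rewrite gerBl ler0n.
split.
- have [|||p pS] := @nested_closure_nonempty R X S.
  + by move=> n; exact: past_image_nonempty.
  + exact: Smono.
  + by move=> eps e0; exact: past_finite_nets_nat.
  by exists p; exact: subset_omega_limit.
- apply: closed_finite_net_compact.
    by apply: closed_bigI => s _; exact: closed_closure.
  move=> eps e0; have e20 : 0 < eps / 2 by rewrite divr_gt0.
  have [tau taut ntau] := nU _ e20; rewrite [eps]splitr.
  apply: finite_net_near ntau => x /(_ tau taut)/(_ (ball x (eps / 2)))[].
    exact: nbhsx_ballx.
  by move=> y [yU]; rewrite -ball_normE; exists y.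
apply/(attracts_atP _ _ Up B0) => eps e0; apply: contrapT => /forall2NP far.
pose D n := S n `&` [set y | forall c, omega_limit U t B c -> eps <= `|y - c|].
have [|||p pD] := @nested_closure_nonempty R X D.
- move=> n; have [/(_ (tn n))//|] := far (t - n%:R).
  move=> /existsNP[y /not_implyP[yS yfar]]; exists y; split => // c wc.
  by rewrite leNgt; apply/negP => yc; apply: yfar; exists c.
- by move=> m n mn x [/(Smono _ _ mn)].
- move=> e /(past_finite_nets_nat nU)[n nS]; exists n.
  by apply: finite_netS nS => x [].
have wp : omega_limit U t B p.
  by apply: subset_omega_limit => n _; apply: closureS (pD n I) => x [].
have [|y [[_ /(_ p wp)]]] := pD 0%N I (ball p eps); first exact: nbhsx_ballx.
by rewrite leNgt -ball_normE /ball_ /= distrC => /negP.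
Qed.

(** The tails of (xi_n) are eventually contained in any given past image, so
    they have a common adherent point. *)
Lemma past_finite_nets_asymptotically_compact :
  (forall B t, bounded_nonempty B -> past_finite_nets U t B) ->
  asymptotically_compact U.
Proof.
move=> nU B t BB tau xi taut tau_cvg xiU.
pose S n := [set xi m | m in [set m | (n <= m)%N]].
have [|||p pS] := @nested_closure_nonempty R X S.
- by move=> n; exists (xi n), n => /=.
- by move=> m n mn _ [k /= nk <-]; exists k => //=; exact: leq_trans nk.
- move=> eps /(nU B t BB)[s _ ns].
  have /cvgrNyPle/(_ s)[N _ Ns] := tau_cvg; exists N.
  apply: finite_netS ns => _ [m /= Nm <-].
  by exists (tau m) => //=; exact: Ns.
(* A cluster point p of (xi_n) is a cluster point 0 of the real sequence of the
   distances to p, for which a convergent subsequence can be extracted. *)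
have : cluster ((fun n => `|p - xi n|) @ \oo) 0.
  apply/cluster_eventuallyP => e n e0.
  have [|_ [[m /= nm <-]]] := pS n I (ball p e); first exact: nbhsx_ballx.
  by rewrite -ball_normE /ball_ /= => /ltW pm; exists m; rewrite //
    sub0r normrN normr_id.
move=> /cluster_eventually_cvg[f f_incr f0]; exists f => //.
apply/cvg_ex; exists p; apply/cvgrPdist_lt => e e0.
move/cvgrPdist_lt : f0 => /(_ e e0); apply: filterS => n /=.
by rewrite sub0r normrN normr_id.
Qed.

End CompleteProcesses.

(** * Monotone dissipativity *)

Section Dissipative.
Context {R : realType} {X : normedModType R}.
Context {U : R -> R -> X -> set X} {B0 : R -> set X}.
Context (Up : m_process U) (Ud : monotonically_dissipative_with U B0).
Implicit Types (B C : set X) (t s tau eps : R).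

(** B_0(t) absorbs {0}, whose images are nonempty. *)
Lemma absorbing_bounded_nonempty t : bounded_nonempty (B0 t).
Proof.
have [[bB0 absB] _] := Ud; split; last exact: bB0.
have [|tau taut tauP] := absB [set 0] t.
  split; first by exists 0.
  by exists 0; split => // z z0 _ ->; rewrite /= normr0 ltW.
have [|y] := image_process_nonempty Up taut (B := [set 0]); first by exists 0.
by move=> /tauP; exists y; auto.
Qed.

(** At time r the evolution of B is inside B_0(r), hence inside B_0(t) by
    monotonicity; the inclusion of the process law does the rest.  It matters
    that the bound holds for each r, as r is later chosen from the attraction
    of B_0(t). *)
Lemma past_image_absorbed t r B : r <= t -> bounded_nonempty B ->
  exists2 s, s <= r & past_image U t s B `<=` image_process U t r (B0 t).
Proof.
have [[_ absB] mB] := Ud; move=> rt BB; have [s sr sP] := absB B r BB.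
exists s => //; apply: bigcup_sub => tau /= taus.
apply: subset_trans (image_processS (mB _ _ rt)).
apply: subset_trans (image_processS (sP tau taus)).
by apply: image_process_trans => //; exact: le_trans sr.
Qed.

Lemma attracts_absorbing_pullback_attracting K :
  (forall t, attracts_at U t (B0 t) (K t)) -> pullback_attracting U K.
Proof.
move=> aK t B BB; have [B00 _] := absorbing_bounded_nonempty t.
apply/(attracts_atP _ _ Up BB.1) => eps e0.
have /(attracts_atP _ _ Up B00)/(_ eps e0)[r rt rP] := aK t.
have [s sr sP] := past_image_absorbed rt BB.
exists s; first exact: le_trans rt.
by move=> y /sP yr; apply: rP; exists r => /=.
Qed.

(** The absorbing set B_0(t) absorbs itself, so omega(t, B_0(t)) lies in its
    closure, which is inside the closure of B_0(T) for t <= T. *)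
Lemma omega_limit_absorbing_backward_bounded :
  backward_bounded (fun t => omega_limit U t (B0 t)).
Proof.
move=> T; have [[bB0 absB] mB] := Ud; have [M [Mr MB]] := bB0 T.
exists (M + 2); split; first by rewrite num_real.
move=> z Mz p [t /= tT wp].
have [tau taut tauP] := absB (B0 t) t (absorbing_bounded_nonempty t).
have [|y [[s /= stau yU]]] := wp tau taut (ball p 1); first exact: nbhsx_ballx.
rewrite -ball_normE /ball_ /= => py.
have yM : `|y| <= M + 1.
  by apply: MB; [rewrite ltrDl|apply: (mB _ _ tT); exact: tauP yU].
rewrite (le_trans _ (ltW Mz))// -(subrK y p) (le_trans (ler_normD _ _))//.
by rewrite (_ : M + 2 = 1 + (M + 1)) ?lerD// ?ltW// addrCA addrC -addrA.
Qed.

End Dissipative.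

(** * The equivalences *)

Unset Implicit Arguments.

Theorem theorem3p10 (R : realType) (X : completeNormedModType R)
    (X_uc : uniformly_convex X)
    (U : R -> R -> X -> set X) (U_process : m_process U)
    (B0 : R -> set X) (U_diss : monotonically_dissipative_with U B0) :
  [<-> asymptotically_compact U;
       forall t : R,
         [/\ omega_limit U t (B0 t) !=set0,
             compact (omega_limit U t (B0 t))
           & attracts_at U t (B0 t) (omega_limit U t (B0 t))];
       omega_limit_compact U;
       pullback_flattening U;
       exists A : R -> set X, pullback_attractor U A /\ backward_bounded A].
Proof.
have B0_bn := absorbing_bounded_nonempty U_process U_diss.
have nets_of_attracting K : compact_nonautonomous K ->
    pullback_attracting U K ->
    forall B t, bounded_nonempty B -> past_finite_nets U t B.
  move=> cK aK B t BB.
  exact: compact_attracts_past_finite_nets BB.1 (cK t) (aK t B BB).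
have omega_attracting :
    (forall t, attracts_at U t (B0 t) (omega_limit U t (B0 t))) ->
    pullback_attracting U (fun t => omega_limit U t (B0 t)).
  exact: attracts_absorbing_pullback_attracting.
tfae.
- move=> aU t; apply: past_finite_nets_omega_limit => //; first exact: (B0_bn t).1.
  exact: asymptotically_compact_past_finite_nets.
- move=> wU; apply/omega_limit_compactP.
  apply: (nets_of_attracting (fun t => omega_limit U t (B0 t))) => [t|].
    by have [] := wU t.
  by apply: omega_attracting => t; have [] := wU t.
- by move=> /omega_limit_compactP; exact: past_finite_nets_pullback_flattening.
- move=> fU.
  have wU t : [/\ omega_limit U t (B0 t) !=set0,
      compact (omega_limit U t (B0 t))
    & attracts_at U t (B0 t) (omega_limit U t (B0 t))].
    apply: past_finite_nets_omega_limit => //; first exact: (B0_bn t).1.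
    exact: pullback_flattening_past_finite_nets.
  exists (fun t => omega_limit U t (B0 t)); split; last first.
    exact: omega_limit_absorbing_backward_bounded.
  split=> [t||C cC aC t]; first by have [] := wU t.
    by apply: omega_attracting => t; have [] := wU t.
  apply: omega_limit_minimal (cC t) (aC t _ (B0_bn t)) => //.
  exact: (B0_bn t).1.
- move=> [A [[cA aA _] _]]; apply: past_finite_nets_asymptotically_compact.
  exact: nets_of_attracting cA aA.
Qed.
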